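(* Let $X$ be a set. (1) A function $\delta:X\times\mathsf PX\to\mathbf\Delta$ is a probabilistic approach structure on $X$ if and only if $\delta$ satisfies, for all $x\in X$, $A,B\subseteq X$, (PD1) $\delta(x,\{x\})=\kappa$, (PD2) $\delta(x,\emptyset)=0$, (PD3) $\delta(x,A\cup B)=\delta(x,A)\vee\delta(x,B)$, and (T') for all $x\in X$, $\mathcal A\subseteq\mathsf PX$, $B\subseteq X$: $\ \delta(x,\bigcup\mathcal A)\ge\bigwedge_{y\in B}\bigvee_{A\in\mathcal A}\big(\delta(x,B)\odot\delta(y,A)\big)$. Equivalently, the function $c:\mathsf PX\to\mathbf\Delta^X$ with $(cA)(x)=\delta(x,A)$ makes $(X,c)$ a $\mathbf\Delta$-approach space. (2) A probabilistic approach structure on $X$ may be described equivalently, via $c^\varphi A=\{x\in X\mid\delta(x,A)\ge\varphi\}$ and $\delta(x,A)=\bigvee\{\varphi\in\mathbf\Delta\mid x\in c^\varphi A\}$, by a family of functions $c^\varphi:\mathsf PX\to\mathsf PX$ ($\varphi\in\mathbf\Delta$) satisfying, for all $A,B\subseteq X$, all $\varphi,\psi,\psi_i,\pi\in\mathbf\Delta$ ($i\in I$, $I$ any index set) with $\pi$ coprime: (PC1) if $\varphi\le\bigvee_{i\in I}\psi_i$, then $\bigcap_{i\in I}c^{\psi_i}A\subseteq c^\varphi A$; (PC2) $A\subseteq c^\kappa A$; (PC3) $c^\varphi c^\psi A\subseteq c^{\varphi\odot\psi}A$; (PC4) $c^\pi(\emptyset)=\emptyset$; (PC5) $c^\pi(A\cup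 B)=c^\pi A\cup c^\pi B$. (3) A map $f:X\to Y$ of probabilistic approach spaces $X,Y$, presented in terms of their respective closure towers $(c^\varphi),(d^\varphi)$, is contractive if and only if $f(c^\varphi A)\subseteq d^\varphi(f(A))$ for all $A\subseteq X$, $\varphi\in\mathbf\Delta$.
   Context: $\mathbf\Delta$ is the quantale of distance distribution functions: all $\varphi:[0,\infty]\to[0,1]$ with $\varphi(\beta)=\sup_{\alpha<\beta}\varphi(\alpha)$ for all $\beta\in[0,\infty]$, ordered pointwise, with $(\varphi\odot\psi)(\gamma)=\sup_{\alpha+\beta\le\gamma}\varphi(\alpha)\psi(\beta)$ and neutral element $\kappa$ given by $\kappa(0)=0$, $\kappa(\alpha)=1$ for $\alpha>0$ (which is also the top element); the bottom element is the constant function $0$. $\mathbf\Delta$ is a completely distributive complete lattice; $\bigvee$, $\bigwedge$ denote joins and meets in it. An element $\pi$ is coprime if $\pi>0$ and $\pi\le\varphi\vee\psi$ always implies $\pi\le\varphi$ or $\pi\le\psi$. $\mathsf PX$ is the power set of $X$; an empty intersection of subsets of $X$ is $X$. A probabilistic approach space is a set $X$ with a function (probabilistic approach structure) $\delta:X\times\mathsf PX\to\mathbf\Delta$ such that for all $x\in X$, $A,B\subseteq X$, $\varphi\in\mathbf\Delta$: (PD1) $\delta(x,\{x\})=\kappa$; (PD2) $\delta(x,\emptyset)=0$; (PD3) $\delta(x,A\cup B)=\delta(x,A)\vee\delta(x,B)$; (PD4) $\delta(x,A)\ge\delta(x,A^{(\varphi)})\odot\varphi$, where $A^{(\varphi)}=\{y\in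 X\mid\delta(y,A)\ge\varphi\}$. A map $f:(X,\delta)\to(Y,\epsilon)$ is contractive if $\delta(x,A)\le\epsilon(f(x),f(A))$ for all $x\in X$, $A\subseteq X$. For a quantale $(\mathsf V,\otimes,\mathsf k)$ (a complete lattice with a monoid structure whose operation $\otimes$ preserves suprema in each variable), a $\mathsf V$-approach space $(X,c)$ is a set $X$ with a map $c:\mathsf PX\to\mathsf V^X$ such that $\mathsf k\le c(\{x\})(x)$; $\big(\bigwedge_{y\in B}\bigvee_{A\in\mathcal A}(cA)(y)\big)\otimes (cB)(z)\le c(\bigcup\mathcal A)(z)$; $(c\emptyset)(x)=\bot$; and $c(A\cup B)(x)=(cA)(x)\vee(cB)(x)$, for all $x,z\in X$, $A,B\subseteq X$, $\mathcal A\subseteq\mathsf PX$.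
   Formalization: In (T') the factor δ(x,B) is taken outside the meet, i.e. δ(x,⋃𝒜) ≥ δ(x,B) ⊙ ⋀_{y∈B}⋁_{A∈𝒜} δ(y,A), because the printed form fails (e.g. B=𝒜=∅ gives κ ≤ δ(x,∅)=0, and also for some finite nonempty B and 𝒜). *)

(* Defs.v *)
From HB Require Import structures.
From mathcomp Require Import all_boot all_order all_algebra.
From mathcomp Require Import boolp classical_sets reals constructive_ereal ereal.

Set Implicit Arguments.
Unset Strict Implicit.
Unset Printing Implicit Defensive.

Import Order.TTheory GRing.Theory Num.Theory.

Local Open Scope classical_set_scope.
Local Open Scope ring_scope.

Record quantale := Quantale {
  qcar :> Type ;
  qle : qcar -> qcar -> Prop ;
  qsup : set qcar -> qcar ;
  qmul : qcar -> qcar -> qcar ;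
  qunit : qcar ;
  qle_refl : forall a, qle a a ;
  qle_trans : forall a b c, qle a b -> qle b c -> qle a c ;
  qle_anti : forall a b, qle a b -> qle b a -> a = b ;
  qsup_ub : forall (S : set qcar) a, S a -> qle a (qsup S) ;
  qsup_lub : forall (S : set qcar) b,
    (forall a, S a -> qle a b) -> qle (qsup S) b ;
  qmulA : forall a b c, qmul a (qmul b c) = qmul (qmul a b) c ;
  qmul1l : forall a, qmul qunit a = a ;
  qmul1r : forall a, qmul a qunit = a ;
  qmul_supr : forall a (S : set qcar), qmul a (qsup S) = qsup (qmul a @` S) ;
  qmul_supl : forall a (S : set qcar),
    qmul (qsup S) a = qsup [set qmul b a | b in S]
}.

Arguments qunit {_}.

Declare Scope quantale_scope.
Delimit Scope quantale_scope with Q.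

Section QuantaleOps.
Context {V : quantale}.

Definition qinf (S : set V) : V := qsup [set a | forall b, S b -> qle a b].
Definition qbot : V := qsup set0.
Definition qjoin (a b : V) : V := qsup [set a; b].

Lemma qinf_lb (S : set V) a : S a -> qle (qinf S) a.
Proof. by move=> Sa; apply: qsup_lub => b; apply. Qed.

Lemma qinf_glb (S : set V) b : (forall a, S a -> qle b a) -> qle b (qinf S).
Proof. by move=> h; apply: qsup_ub. Qed.

Definition is_coprime (p : V) : Prop :=
  [/\ qle qbot p, p <> qbot &
      forall a b : V, qle p (qjoin a b) -> qle p a \/ qle p b].

End QuantaleOps.

Notation "a ⊑ b" := (qle a b) (at level 70, no associativity) : quantale_scope.
Notation "a ⊗ b" := (qmul a b) (at level 40, left associativity)
  : quantale_scope.
Notation "a ⊔ b" := (qjoin a b) (at level 50, left associativity)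
  : quantale_scope.
Notation "⋁ S" := (qsup S) (at level 35, right associativity)
  : quantale_scope.
Notation "⋀ S" := (qinf S) (at level 35, right associativity)
  : quantale_scope.

Local Open Scope quantale_scope.

Definition is_V_approach (V : quantale) (X : Type) (c : set X -> X -> V)
    : Prop :=
  [/\ forall x, qunit ⊑ c [set x] x,
      forall (AA : set (set X)) (B : set X) z,
        (⋀ [set ⋁ [set c A y | A in AA] | y in B]) ⊗ c B z
          ⊑ c (\bigcup_(A in AA) A) z,
      forall x, c set0 x = qbot
    & forall A B x, c (A `|` B) x = c A x ⊔ c B x].

Section Sup01.
Context {R : realType}.
Implicit Types (S : set R) (t : R).

Lemma sup01_ub S t : (forall x, S x -> x <= 1) -> S t -> t <= sup S.
Proof. by move=> h St; apply: (ub_le_sup _ St); exists 1. Qed.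

Lemma sup01_le S t : 0 <= t -> (forall x, S x -> x <= t) -> sup S <= t.
Proof.
move=> t0 h; have [->|/set0P S0] := eqVneq S set0; first by rewrite sup0.
exact: ge_sup.
Qed.

Lemma sup01_gt S t : 0 <= t -> t < sup S -> exists2 x, S x & t < x.
Proof.
move=> t0 h; apply: contrapT => /forall2NP h'.
have := sup01_le t0 (S := S); rewrite leNgt h => /(_ _)/negP []// x Sx.
by case: (h' x) => // /negP; rewrite -leNgt.
Qed.

Lemma sup01_ge0 S : (forall x, S x -> 0 <= x <= 1) -> 0 <= sup S.
Proof.
move=> h; have [->|/set0P [x Sx]] := eqVneq S set0; first by rewrite sup0.
have /andP[x0 _] := h _ Sx; apply: le_trans x0 _.
by apply: sup01_ub => // y /h /andP[].
Qed.

End Sup01.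

(* The interval [0, oo]. *)
Definition edist (R : realType) : Type := {x : \bar R | (0 <= x)%E}.

(* [sup] is the supremum in the reals, with [sup set0 = 0]; on subsets of
   [0, 1] it is therefore the supremum computed in [0, 1]. *)
Record ddf (R : realType) := DDF {
  dval :> edist R -> R ;
  dval01 : forall b, 0 <= dval b <= 1 ;
  dval_sup : forall b,
    dval b = sup [set dval a | a in [set a | (val a < val b)%E]]
}.

Section DDF.
Context {R : realType}.
Implicit Types (a b c : edist R) (f g h : ddf R).

Lemma ddf_ge0 f a : 0 <= f a. Proof. by case/andP: (dval01 f a). Qed.
Lemma ddf_le1 f a : f a <= 1. Proof. by case/andP: (dval01 f a). Qed.

Lemma ddf_eq f g : (forall a, f a = g a) -> f = g.
Proof.
case: f g => [f f1 f2] [g g1 g2] /= /funext E; case: g / E in g1 g2 *.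
by congr DDF; exact: Prop_irrelevance.
Qed.

Lemma ddf_mono f a b : (val a <= val b)%E -> f a <= f b.
Proof.
rewrite le_eqVlt => /orP[/eqP/val_inj->//|ab].
rewrite (dval_sup f b); apply: sup01_ub; last by exists a.
by move=> _ [x _ <-]; exact: ddf_le1.
Qed.

Lemma ddf_approx f b (t : R) : 0 <= t -> t < f b ->
  exists2 a, (val a < val b)%E & t < f a.
Proof.
move=> t0; rewrite dval_sup => /(sup01_gt t0)[_ [a ab <-]] ta.
by exists a.
Qed.

Lemma approx_sup (F : edist R -> R) :
    (forall b, 0 <= F b <= 1) ->
    (forall a b, (val a <= val b)%E -> F a <= F b) ->
    (forall b t, 0 <= t -> t < F b -> exists2 a, (val a < val b)%E & t < F a) ->
  forall b, F b = sup [set F a | a in [set a | (val a < val b)%E]].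
Proof.
move=> F01 Fm Fa b; apply/eqP; rewrite eq_le; apply/andP; split.
  rewrite leNgt; apply/negP => /Fa[|a ab].
    by apply: sup01_ge0 => _ [x _ <-]; exact: F01.
  rewrite ltNge => /negP; apply; apply: sup01_ub; last by exists a.
  by move=> _ [x _ <-]; case/andP: (F01 x).
apply: sup01_le; first by case/andP: (F01 b).
by move=> _ [x xb <-]; apply: Fm; exact: ltW.
Qed.

Definition ddf_le f g : Prop := forall a, f a <= g a.

Section Zero.
Let F (_ : edist R) : R := 0.

Let F01 b : 0 <= F b <= 1. Proof. by rewrite lexx ler01. Qed.

Let Fsup b : F b = sup [set F a | a in [set a | (val a < val b)%E]].
Proof.
apply: approx_sup => // b' t t0; by rewrite ltNge t0.
Qed.

Definition ddf_zero : ddf R := DDF F01 Fsup.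
End Zero.

Section Kappa.
Let F (a : edist R) : R := if (val a == 0)%E then 0 else 1.

Let F01 b : 0 <= F b <= 1.
Proof. by rewrite /F; case: ifP; rewrite ?lexx ?ler01. Qed.

Let Fsup b : F b = sup [set F a | a in [set a | (val a < val b)%E]].
Proof.
apply: approx_sup => //.
  move=> x y xy; rewrite /F; case: ifP => [_|/negbT x0].
    by case: ifP; rewrite ?lexx ?ler01.
  case: ifP => // /eqP y0; case/negP: x0.
  by rewrite y0 in xy; rewrite eq_le xy (valP x).
move=> {}b t t0; rewrite {1}/F; case: ifP => [_|/negbT b0 t1].
  by rewrite ltNge t0.
have bgt0 : (0 < val b)%E by rewrite lt_def b0 (valP b).
have [r r0 rb] : exists2 r : R, 0 < r & (r%:E < val b)%E.
  case: (val b) bgt0 => [s| |]//.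
    rewrite lte_fin => s0; exists (s / 2); first by rewrite divr_gt0.
    by rewrite lte_fin ltr_pdivrMr// ltr_pMr// ltr1n.
  by move=> _; exists 1 => //; rewrite ltry.
have r0' : (0 <= r%:E)%E by rewrite lee_fin ltW.
by exists (exist _ r%:E r0') => //; rewrite /F /= eqe gt_eqF.
Qed.

Definition ddf_kappa : ddf R := DDF F01 Fsup.
End Kappa.

Section Join.
Variable S : set (ddf R).
Let F (a : edist R) : R := sup [set f a | f in S].

Let F01 b : 0 <= F b <= 1.
Proof.
apply/andP; split.
  by apply: sup01_ge0 => _ [f _ <-]; exact: dval01.
by apply: sup01_le => // _ [f _ <-]; exact: ddf_le1.
Qed.

Let Fsup b : F b = sup [set F a | a in [set a | (val a < val b)%E]].
Proof.
have Fub f a : S f -> f a <= F a.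
  by move=> Sf; apply: sup01_ub => [_ [g _ <-]|]; [exact: ddf_le1|exists f].
apply: approx_sup => //.
  move=> x y xy; apply: sup01_le; first by case/andP: (F01 y).
  by move=> _ [f Sf <-]; apply: le_trans (Fub _ _ Sf); exact: ddf_mono.
move=> {}b t t0 /(sup01_gt t0) [_ [f Sf <-]] /(ddf_approx t0) [a ab ta].
by exists a => //; apply: lt_le_trans ta (Fub _ _ Sf).
Qed.

Definition ddf_sup : ddf R := DDF F01 Fsup.
End Join.

Section Conv.
Variables f g : ddf R.
Let S (c : edist R) : set R :=
  [set x | exists a b, (val a + val b <= val c)%E /\ x = f a * g b].
Let F (c : edist R) : R := sup (S c).

Let S01 c x : S c x -> 0 <= x <= 1.
Proof.
move=> [a [b [_ ->]]]; rewrite mulr_ge0 ?ddf_ge0//=.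
by rewrite mulr_ile1 ?ddf_ge0 ?ddf_le1.
Qed.

Let F01 c : 0 <= F c <= 1.
Proof.
apply/andP; split; first by apply: sup01_ge0 => x /S01.
by apply: sup01_le => // x /S01/andP[].
Qed.

Let Fsup b : F b = sup [set F a | a in [set a | (val a < val b)%E]].
Proof.
have Fub c x : S c x -> x <= F c.
  by apply: sup01_ub => y /S01 /andP[].
apply: approx_sup => //.
  move=> x y xy; apply: sup01_le; first by case/andP: (F01 y).
  move=> _ [a [b' [h ->]]]; apply: Fub; exists a, b'; split => //.
  exact: le_trans h xy.
move=> c t t0 /(sup01_gt t0) [_ [a [b' [h ->]]]] tab.
have fg0 : 0 < f a * g b' by apply: le_lt_trans tab.
have gb0 : 0 < g b'.
  rewrite lt_def ddf_ge0 andbT; apply/eqP => g0.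
  by move: fg0; rewrite g0 mulr0 ltxx.
have [a' a'a ta'] : exists2 a', (val a' < val a)%E & t < f a' * g b'.
  have [|a' aa] := @ddf_approx f a (t / g b') (divr_ge0 t0 (ltW gb0)).
    by rewrite ltr_pdivrMr.
  by rewrite ltr_pdivrMr// => ?; exists a'.
have fa0 : 0 < f a'.
  rewrite lt_def ddf_ge0 andbT; apply/eqP => f0.
  by move: (le_lt_trans t0 ta'); rewrite f0 mul0r ltxx.
have [b'' bb tb] : exists2 b'', (val b'' < val b')%E & t < f a' * g b''.
  have [|b'' bb] := @ddf_approx g b' (t / f a') (divr_ge0 t0 (ltW fa0)).
    by rewrite ltr_pdivrMr// mulrC.
  by rewrite ltr_pdivrMr// mulrC => ?; exists b''.
have d0 : (0 <= val a' + val b'')%E by rewrite adde_ge0// (valP a', valP b'').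
exists (exist _ (val a' + val b'')%E d0) => /=.
  by apply: lt_le_trans h; apply: lteD.
by apply: lt_le_trans tb _; apply: Fub; exists a', b''; rewrite lexx.
Qed.

Definition ddf_conv : ddf R := DDF F01 Fsup.

Lemma ddf_conv_ub a b c : (val a + val b <= val c)%E ->
  f a * g b <= ddf_conv c.
Proof.
move=> h; apply: sup01_ub; last by exists a, b.
by move=> y /S01 /andP[].
Qed.

Lemma ddf_conv_le c (t : R) : 0 <= t ->
  (forall a b, (val a + val b <= val c)%E -> f a * g b <= t) ->
  ddf_conv c <= t.
Proof. by move=> t0 h; apply: sup01_le => // _ [a [b [ab ->]]]; exact: h. Qed.

End Conv.

Lemma sup_mul_le (S : set R) (r t : R) : 0 <= r -> 0 <= t ->
  (forall x, S x -> x * r <= t) -> sup S * r <= t.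
Proof.
move=> r0 t0 h; have [->|rN0] := eqVneq r 0; first by rewrite mulr0.
have {rN0}r0 : 0 < r by rewrite lt_def rN0.
rewrite -ler_pdivlMr//; apply: sup01_le; first by rewrite divr_ge0// ltW.
by move=> x /h; rewrite -ler_pdivlMr.
Qed.

Lemma ddf_le_anti f g : ddf_le f g -> ddf_le g f -> f = g.
Proof. by move=> fg gf; apply: ddf_eq => a; apply/eqP; rewrite eq_le fg gf. Qed.

Lemma ddf_convC f g : ddf_conv f g = ddf_conv g f.
Proof.
suff H f' g' : ddf_le (ddf_conv f' g') (ddf_conv g' f').
  by apply: ddf_le_anti; exact: H.
move=> c; apply: ddf_conv_le => [|a b ab]; first exact: ddf_ge0.
by rewrite mulrC; apply: ddf_conv_ub; rewrite addeC.
Qed.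

Lemma ddf_conv_mono f g f' g' : ddf_le f f' -> ddf_le g g' ->
  ddf_le (ddf_conv f g) (ddf_conv f' g').
Proof.
move=> ff gg c; apply: ddf_conv_le => [|a b ab]; first exact: ddf_ge0.
apply: le_trans (ddf_conv_ub f' g' ab).
by apply: ler_pM => //; exact: ddf_ge0.
Qed.

Lemma ddf_convA f g h :
  ddf_conv f (ddf_conv g h) = ddf_conv (ddf_conv f g) h.
Proof.
have H f' g' h' :
    ddf_le (ddf_conv (ddf_conv f' g') h') (ddf_conv f' (ddf_conv g' h')).
  move=> c; apply: ddf_conv_le => [|a b ab]; first exact: ddf_ge0.
  apply: sup_mul_le; [exact: ddf_ge0|exact: ddf_ge0|].
  move=> _ [a1 [a2 [a12 ->]]].
  have d0 : (0 <= val a2 + val b)%E by rewrite adde_ge0// (valP a2, valP b).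
  pose e : edist R := exist _ (val a2 + val b)%E d0; rewrite -mulrA.
  apply: (@le_trans _ _ (f' a1 * ddf_conv g' h' e)).
    apply: ler_wpM2l; first exact: ddf_ge0.
    exact: ddf_conv_ub.
  apply: ddf_conv_ub => /=; rewrite addeA.
  by apply: le_trans ab; exact: leeD2r.
apply: ddf_le_anti => //.
rewrite ddf_convC (ddf_convC g h) (ddf_convC (ddf_conv f g)) (ddf_convC f).
exact: H.
Qed.

Lemma ddf_conv1 f : ddf_conv ddf_kappa f = f.
Proof.
apply: ddf_le_anti => c.
  apply: ddf_conv_le => [|a b ab]; first exact: ddf_ge0.
  apply: (@le_trans _ _ (f b)).
    by apply: ler_piMl; [exact: ddf_ge0|exact: ddf_le1].
  by apply: ddf_mono; apply: le_trans ab; rewrite leeDr// (valP a).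
rewrite leNgt; apply/negP => /ddf_approx [|b bc].
  exact: ddf_ge0.
rewrite ltNge => /negP; apply.
have bfin : val b \is a fin_num.
  rewrite fin_numE; apply/andP; split; apply/eqP => e.
    by have := valP b; rewrite e.
  by move: bc; rewrite e ltNge leey.
have d0 : (0 < val c - val b)%E by rewrite sube_gt0.
have <- : ddf_kappa (exist _ (val c - val b)%E (ltW d0)) * f b = f b.
  by rewrite /= gt_eqF// mul1r.
by apply: ddf_conv_ub => /=; rewrite subeK.
Qed.

Lemma ddf_sup_ub (S : set (ddf R)) f : S f -> ddf_le f (ddf_sup S).
Proof.
move=> Sf a; apply: sup01_ub; last by exists f.
by move=> _ [g _ <-]; exact: ddf_le1.
Qed.

Lemma ddf_sup_lub (S : set (ddf R)) g :
  (forall f, S f -> ddf_le f g) -> ddf_le (ddf_sup S) g.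
Proof.
move=> h a; apply: sup01_le; first exact: ddf_ge0.
by move=> _ [f Sf <-]; exact: h.
Qed.

Lemma ddf_conv_supl f (S : set (ddf R)) :
  ddf_conv (ddf_sup S) f = ddf_sup [set ddf_conv g f | g in S].
Proof.
apply: ddf_le_anti.
  move=> c; apply: ddf_conv_le => [|a b ab]; first exact: ddf_ge0.
  apply: sup_mul_le; [exact: ddf_ge0|exact: ddf_ge0|].
  move=> _ [g Sg <-]; apply: le_trans (ddf_conv_ub g f ab) _.
  by apply: ddf_sup_ub; exists g.
apply: ddf_sup_lub => _ [g Sg <-]; apply: ddf_conv_mono => [|a //].
exact: ddf_sup_ub.
Qed.

Lemma ddf_conv_supr f (S : set (ddf R)) :
  ddf_conv f (ddf_sup S) = ddf_sup (ddf_conv f @` S).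
Proof.
rewrite ddf_convC ddf_conv_supl; congr ddf_sup.
by apply: eq_imagel => g _; exact: ddf_convC.
Qed.

Lemma ddf_le_refl f : ddf_le f f. Proof. by []. Qed.

Lemma ddf_le_trans f g h : ddf_le f g -> ddf_le g h -> ddf_le f h.
Proof. by move=> fg gh a; exact: le_trans (fg a) (gh a). Qed.

Lemma ddf_convr1 f : ddf_conv f ddf_kappa = f.
Proof. by rewrite ddf_convC ddf_conv1. Qed.

End DDF.

Canonical Delta (R : realType) : quantale :=
  @Quantale (ddf R) ddf_le ddf_sup ddf_conv ddf_kappa
    ddf_le_refl ddf_le_trans ddf_le_anti ddf_sup_ub ddf_sup_lub
    ddf_convA ddf_conv1 ddf_convr1 ddf_conv_supr ddf_conv_supl.

Lemma Delta_bot (R : realType) : @qbot (Delta R) = @ddf_zero R.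
Proof.
apply: ddf_le_anti; last by move=> a; exact: ddf_ge0.
by apply: ddf_sup_lub => f [].
Qed.

Lemma Delta_top (R : realType) (f : Delta R) : f ⊑ @ddf_kappa R.
Proof.
move=> a; rewrite /=; case: ifPn => [/eqP a0|_]; last exact: ddf_le1.
rewrite leNgt; apply/negP => /(ddf_approx (lexx 0)) [b /= ba].
by rewrite a0 in ba; have := valP b; rewrite /= leNgt ba.
Qed.

Arguments ddf_zero {R}.
Arguments ddf_kappa {R}.

Section ProbabilisticApproach.
Context {R : realType} {X : Type}.
Implicit Types (d : X -> set X -> Delta R).

Definition PD1 d : Prop := forall x, d x [set x] = ddf_kappa.

Definition PD2 d : Prop := forall x, d x set0 = ddf_zero.

Definition PD3 d : Prop := forall x A B, d x (A `|` B) = d x A ⊔ d x B.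

Definition level d (phi : Delta R) (A : set X) : set X :=
  [set y | phi ⊑ d y A].

Definition PD4 d : Prop := forall x A phi, d x (level d phi A) ⊗ phi ⊑ d x A.

(* The factor d(x,B) must stay outside the meet.  In the form
     /\_(y in B) \/_(A in AA) (d(x,B) . d(y,A)) <= d(x, U AA)
   the choice AA = B = set0 would read kappa <= d(x, set0), against PD2, and
   the inequality also fails for finite nonempty AA and B. *)
Definition PDT d : Prop := forall x (AA : set (set X)) (B : set X),
  d x B ⊗ (⋀ [set ⋁ [set d y A | A in AA] | y in B])
    ⊑ d x (\bigcup_(A in AA) A).

Definition is_prob_approach d : Prop := [/\ PD1 d, PD2 d, PD3 d & PD4 d].

Definition is_closure_tower (c : Delta R -> set X -> set X) : Prop :=
  [/\ forall (A : set X) (phi : Delta R) (I : Type) (psi : I -> Delta R),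
        phi ⊑ ⋁ (range psi) -> \bigcap_i c (psi i) A `<=` c phi A,
      forall A, A `<=` c ddf_kappa A,
      forall A phi psi, c phi (c psi A) `<=` c (phi ⊗ psi) A,
      forall pi, is_coprime pi -> c pi set0 = set0
    & forall pi A B, is_coprime pi -> c pi (A `|` B) = c pi A `|` c pi B].

Definition tower_dist (c : Delta R -> set X -> set X) (x : X) (A : set X)
    : Delta R :=
  ⋁ [set phi | c phi A x].

End ProbabilisticApproach.

Definition contractive {R : realType} {X Y : Type}
    (d : X -> set X -> Delta R) (e : Y -> set Y -> Delta R) (f : X -> Y)
    : Prop :=
  forall x A, d x A ⊑ e (f x) (f @` A).

(* Main.v *)
Require Import Defs.
From mathcomp Require Import all_boot all_order all_algebra.
From mathcomp Require Import boolp classical_sets reals constructive_ereal ereal.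

(** Monotonicity of a distance in its set argument, which (PD3) provides, makes
    (PD4) and (T') equivalent: with [phi] the meet in (T'), [B] is contained in
    the [phi]-level of the union.  A tower satisfying (PC1) is recovered from
    its distance by taking levels.  Transporting (PC4) and (PC5), which only
    concern coprime indices, to (PD2) and (PD3) rests on the fact that every
    distance distribution function is the join of the one-step functions below
    it, and that one-step functions are coprime. *)

Import Order.TTheory Num.Theory.

Local Open Scope classical_set_scope.
Local Open Scope ring_scope.
Local Open Scope quantale_scope.

(** * Joins and multiplication in a quantale *)

Section QuantaleTheory.
Context {V : quantale}.
Implicit Types a b p : V.

Lemma qbot_le a : qbot ⊑ a.
Proof. by apply: qsup_lub. Qed.

Lemma qjoin_ubl a b : a ⊑ a ⊔ b.
Proof. by apply: qsup_ub; left. Qed.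

Lemma qjoin_ubr a b : b ⊑ a ⊔ b.
Proof. by apply: qsup_ub; right. Qed.

Lemma qjoin_lub {a b p} : a ⊑ p -> b ⊑ p -> a ⊔ b ⊑ p.
Proof. by move=> ap bp; apply: qsup_lub => q [->|->]. Qed.

Lemma qjoin_idr {a b} : a ⊑ b -> a ⊔ b = b.
Proof.
move=> ab; apply: qle_anti; last exact: qjoin_ubr.
by apply: qjoin_lub => //; exact: qle_refl.
Qed.

Lemma qmul_le2l p {a b} : a ⊑ b -> p ⊗ a ⊑ p ⊗ b.
Proof.
move=> /qjoin_idr <-; rewrite /qjoin qmul_supr.
by apply: qsup_ub; exists a => //; left.
Qed.

Lemma qmul_le2r p {a b} : a ⊑ b -> a ⊗ p ⊑ b ⊗ p.
Proof.
move=> /qjoin_idr <-; rewrite /qjoin qmul_supl.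
by apply: qsup_ub; exists a => //; left.
Qed.

Lemma coprime_not_le_bot p : is_coprime p -> ~ p ⊑ qbot.
Proof. by move=> [p0 pN0 _] /qle_anti /(_ p0). Qed.

End QuantaleTheory.

(** * Step functions and generation of [Delta] by coprime elements *)

Section StepFunctions.
Context {R : realType}.
Implicit Types (a b : edist R) (t : R) (phi psi : Delta R).

Lemma edist_dense {a b} : (val a < val b)%E ->
  exists2 c : edist R, (val a < val c)%E & (val c < val b)%E.
Proof.
move=> ab; have [r ar rb] : exists2 r : R, (val a < r%:E)%E & (r%:E < val b)%E.
  case: (val a) (valP a) (val b) ab => [x| |] //= _ [y| |] //=.
  - rewrite lte_fin => xy; exists ((x + y) / 2); rewrite lte_fin.
      by rewrite midf_lt.
    by rewrite midf_lt.
  - by move=> _; exists (x + 1); rewrite ?ltry// lte_fin ltrDl.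
have r0 : (0 <= r%:E)%E by apply: le_trans (ltW ar); exact: valP a.
by exists (exist _ r%:E r0).
Qed.

Section Step.
Variables (a : edist R) (t : R).
Hypothesis t01 : 0 <= t <= 1.
(** The strict inequality gives the value 0 at [a] itself, as left continuity demands. *)
Let F b : R := if (val a < val b)%E then t else 0.

Let F01 b : 0 <= F b <= 1.
Proof. by rewrite /F; case: ifP; rewrite ?t01 ?lexx ?ler01. Qed.

Let Fsup b : F b = sup [set F c | c in [set c | (val c < val b)%E]].
Proof.
apply: approx_sup => // [x y xy|{}b s s0].
  rewrite /F; case: ifP => [ax|_]; first by rewrite (lt_le_trans ax xy).
  by case: ifP; case/andP: t01.
rewrite {1}/F; case: ifP => [ab st|_]; last by rewrite ltNge s0.
by have [c ac cb] := edist_dense ab; exists c => //; rewrite /F ac.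
Qed.

Definition step : Delta R := DDF F01 Fsup.

Lemma step_gt b : (val a < val b)%E -> step b = t.
Proof. by rewrite /= /F => ->. Qed.

Lemma step_leP phi :
  step ⊑ phi <-> forall b, (val a < val b)%E -> t <= phi b.
Proof.
split=> [h b ab|h b]; first by have := h b; rewrite step_gt.
by rewrite /= /F; case: ifP => [/h//|_]; exact: ddf_ge0.
Qed.

End Step.

Lemma Delta_joinE phi psi b : (phi ⊔ psi) b = Num.max (phi b) (psi b).
Proof.
apply/eqP; rewrite eq_le; apply/andP; split.
  apply: sup01_le; first by rewrite le_max ddf_ge0.
  by move=> _ [f [->|->] <-]; rewrite le_max lexx ?orbT.
rewrite ge_max; apply/andP; split; first exact: (qjoin_ubl phi psi).
exact: (qjoin_ubr phi psi).
Qed.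

(** If the step lies below neither [phi] nor [psi], each drops below [t] at some point past [a]. By
    monotonicity both are below [t] at the smaller of the two points, and so is their pointwise
    maximum. The point [b] only witnesses that the step is nonzero. *)
Lemma step_coprime a b t (t01 : 0 <= t <= 1) :
  (val a < val b)%E -> 0 < t -> is_coprime (step a t t01).
Proof.
move=> ab t0; split; first exact: qbot_le.
  move=> /(congr1 (fun f : Delta R => f b)); rewrite step_gt// Delta_bot /=.
  by move=> tE; rewrite tE ltxx in t0.
move=> phi psi /step_leP h; apply: contrapT => /not_orP[].
move=> /step_leP/existsNP[c /not_implyP[ac /negP]]; rewrite -ltNge => phic.
move=> /step_leP/existsNP[e /not_implyP[ae /negP]]; rewrite -ltNge => psie.
wlog ce : phi psi c e h ac phic ae psie / (val c <= val e)%E => [wl|].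
  have [ce|/ltW ec] := leP (val c) (val e); first exact: (wl phi psi c e).
  apply: (wl psi phi e c) => // x /h; by rewrite !Delta_joinE maxC.
have := h _ ac; rewrite Delta_joinE leNgt gt_max phic /=.
by rewrite (le_lt_trans (ddf_mono psi ce) psie).
Qed.

(** If [phi b] exceeded the join at [b], left continuity would give [a] before [b] with [phi a]
    still above it; but the step of height [phi a] starting at [a] lies below [phi] and takes the
    value [phi a] at [b]. *)
Lemma Delta_coprime_gen phi :
  phi = ⋁ [set pi | is_coprime pi /\ pi ⊑ phi].
Proof.
apply: qle_anti; last by apply: qsup_lub => pi [].
move=> b; rewrite leNgt; apply/negP => /ddf_approx[|a ab]; first exact: ddf_ge0.
rewrite ltNge => /negP; apply.
have [->|pa0] := eqVneq (phi a) 0; first exact: ddf_ge0.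
pose pi := step a (phi a) (dval01 phi a).
rewrite -(step_gt a (phi a) (dval01 phi a) b ab).
suff : pi ⊑ ⋁ [set pi | is_coprime pi /\ pi ⊑ phi] by apply.
apply: qsup_ub; split.
  by apply: (step_coprime _ b) => //; rewrite lt_def pa0 ddf_ge0.
by apply/step_leP => c ac; apply: ddf_mono; exact: ltW.
Qed.

Lemma Delta_le_coprime {phi psi} :
  (forall pi, is_coprime pi -> pi ⊑ phi -> pi ⊑ psi) -> phi ⊑ psi.
Proof.
by move=> h; rewrite (Delta_coprime_gen phi); apply: qsup_lub => pi []; exact: h.
Qed.

End StepFunctions.

(** * From distances to (T'), [V]-approach spaces and closure towers *)

Section Distances.
Context {R : realType} {X : Type}.
Implicit Types (d : X -> set X -> Delta R) (A B : set X).

Lemma PD3_mono {d} : PD3 d -> forall x A B, A `<=` B -> d x A ⊑ d x B.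
Proof. by move=> d3 x A B /setUidPr <-; rewrite d3; exact: qjoin_ubl. Qed.

Lemma PD4_PDT d : PD3 d -> PD4 d <-> PDT d.
Proof.
move=> d3; split=> [d4 x AA B|dT x A phi].
  apply: qle_trans (d4 _ _ _); apply/qmul_le2r/(PD3_mono d3) => y By.
  apply: (@qle_trans _ _ (⋁ [set d y A | A in AA])).
    by apply: qinf_lb; exists y.
  apply: qsup_lub => _ [A AAA <-]; apply: (PD3_mono d3).
  exact: bigcup_sup.
(* On this [B] every distance to [A] is at least [phi], hence so is the meet in (T'). *)
have := dT x [set A] (level d phi A); rewrite bigcup_set1; apply: qle_trans.
apply/qmul_le2l/qinf_glb => _ [y phiy <-]; apply: qle_trans phiy _.
by apply: qsup_ub; exists A.
Qed.

Lemma is_prob_approach_PDT d :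
  is_prob_approach d <-> [/\ PD1 d, PD2 d, PD3 d & PDT d].
Proof. by split=> -[d1 d2 d3 /(PD4_PDT _ d3) d4]; split. Qed.

(** The order of the factors is immaterial because convolution is commutative, and the inequality
    for singletons yields (PD1) because [ddf_kappa] is the top element. *)
Lemma PDT_V_approach d : [/\ PD1 d, PD2 d, PD3 d & PDT d] <->
  is_V_approach (fun A x => d x A).
Proof.
split=> [[d1 d2 d3 dT]|[d1 dT d2 d3]]; split.
- by move=> x; rewrite d1; exact: qle_refl.
- by move=> AA B z; rewrite /qmul /= ddf_convC; exact: dT.
- by move=> x; rewrite d2 Delta_bot.
- by move=> A B x; exact: d3.
- by move=> x; apply: (@qle_anti (Delta R)); [exact: Delta_top|exact: d1].
- by move=> x; rewrite d2 Delta_bot.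
- by move=> x A B; exact: d3.
- by move=> x AA B; rewrite /qmul /= ddf_convC; exact: dT.
Qed.

Lemma level_closure_tower d : is_prob_approach d -> is_closure_tower (level d).
Proof.
move=> [d1 d2 d3 d4]; split.
- move=> A phi I psi phile x hx; apply: qle_trans phile _.
  by apply: qsup_lub => _ [i _ <-]; exact: hx.
- move=> A x Ax; rewrite /level /= -(d1 x).
  by apply: (PD3_mono d3) => _ ->.
- by move=> A phi psi x phix; apply: qle_trans (d4 x A psi); exact: qmul_le2r.
- move=> pi /coprime_not_le_bot piN; apply/seteqP; split => // x.
  by rewrite /level /= d2 -Delta_bot.
- move=> pi A B [_ _ pic]; apply/seteqP; split=> x; rewrite /level /= d3.
    exact: pic.
  by case=> h; apply: qle_trans h _; [exact: qjoin_ubl|exact: qjoin_ubr].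
Qed.

Lemma tower_dist_level d x A : tower_dist (level d) x A = d x A.
Proof.
apply: (@qle_anti (Delta R)); first exact: qsup_lub.
by apply: qsup_ub; exact: qle_refl.
Qed.

End Distances.

(** * From closure towers back to distances *)

Section Towers.
Context {R : realType} {X : Type} {c : Delta R -> set X -> set X}.
Hypothesis ct : is_closure_tower c.
Implicit Types (A B : set X) (phi psi : Delta R).

(** This is (PC1) for a set of indices, viewed as a family over its subtype. *)
Lemma tower_sup {A phi} {S : set (Delta R)} {x} :
  phi ⊑ ⋁ S -> (forall psi, S psi -> c psi A x) -> c phi A x.
Proof.
case: ct => c1 _ _ _ _ phiS h.
apply: (c1 A phi {psi | S psi} (fun s => sval s)) => [|[psi Spsi] _]; last exact: h.
apply: qle_trans phiS _; apply: qsup_lub => psi Spsi; apply: qsup_ub.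
by exists (exist _ psi Spsi).
Qed.

Lemma tower_antitone {A phi psi x} : phi ⊑ psi -> c psi A x -> c phi A x.
Proof.
move=> le cx; apply: (@tower_sup _ _ [set psi]) => [|_ -> //].
by apply: qle_trans le _; exact: qsup_ub.
Qed.

(** (PC5) gives this only at coprime indices; (PC1) extends it to [phi], the join of the coprimes
    below it. *)
Lemma tower_mono {A B phi} : A `<=` B -> c phi A `<=` c phi B.
Proof.
case: ct => _ _ _ _ c5 /setUidPr <- x cx.
rewrite (Delta_coprime_gen phi); apply: (tower_sup (qle_refl _)) => pi [pic le].
by rewrite c5//; left; exact: tower_antitone cx.
Qed.

(** By (PC1) the indices whose closure of [A] contains [x] form a principal down-set, so the join
    defining the distance is attained. *)
Lemma tower_distP {phi A x} : phi ⊑ tower_dist c x A <-> c phi A x.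
Proof. by split=> [/tower_sup|cx]; [apply|exact: qsup_ub]. Qed.

Lemma level_tower_dist phi A : level (tower_dist c) phi A = c phi A.
Proof. by apply/seteqP; split=> x /tower_distP. Qed.

Lemma tower_dist_prob_approach : is_prob_approach (tower_dist c).
Proof.
case: (ct) => c1 c2 c3 c4 c5; split.
- move=> x; apply: (@qle_anti (Delta R)); first exact: Delta_top.
  by apply/tower_distP/c2.
- move=> x; rewrite -Delta_bot; apply: qle_anti; last exact: qbot_le.
  (* By (PC4) no coprime lies below the distance to the empty set, so that distance is the
     bottom. *)
  by apply: Delta_le_coprime => pi /c4 pi0 /tower_distP; rewrite pi0.
- move=> x A B; apply: (@qle_anti (Delta R)); last first.
    apply: qjoin_lub; apply/tower_distP;
      [apply: (tower_mono (@subsetUl _ A B))|apply: (tower_mono (@subsetUr _ A B))];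
      by apply/tower_distP; exact: qle_refl.
  (* Testing on coprimes brings the inequality within reach of (PC5). *)
  apply: Delta_le_coprime => pi pic /tower_distP; rewrite c5//.
  by case=> /tower_distP h; apply: qle_trans h _;
    [exact: qjoin_ubl|exact: qjoin_ubr].
- move=> x A phi; rewrite level_tower_dist.
  by apply/tower_distP/c3/tower_distP; exact: qle_refl.
Qed.

End Towers.

(** By [tower_distP], closure membership is a lower bound on a distance, so the inclusions compare
    the lower bounds of the two distances. *)
Lemma contractive_towerP (R : realType) (X Y : Type)
    (c : Delta R -> set X -> set X) (d : Delta R -> set Y -> set Y) (f : X -> Y) :
  is_closure_tower c -> is_closure_tower d ->
  contractive (tower_dist c) (tower_dist d) f <->
  forall A phi, f @` (c phi A) `<=` d phi (f @` A).
Proof.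
move=> ct dt; split=> [h A phi _ [x cx <-]|h x A].
  by apply/(tower_distP dt)/(qle_trans _ (h x A))/(tower_distP ct).
by apply: qsup_lub => phi cx; apply/(tower_distP dt)/h; exists x.
Qed.

Theorem corollary2p14 (R : realType) (X : Type) :
  [/\
    forall d : X -> set X -> Delta R,
      (is_prob_approach d <-> [/\ PD1 d, PD2 d, PD3 d & PDT d]) /\
      (is_prob_approach d <->
         is_V_approach (fun (A : set X) (x : X) => d x A)),

    (forall d : X -> set X -> Delta R, is_prob_approach d ->
       is_closure_tower (level d) /\
       (forall x A, tower_dist (level d) x A = d x A)) /\
    (forall c : Delta R -> set X -> set X, is_closure_tower c ->
       is_prob_approach (tower_dist c) /\
       (forall phi A, level (tower_dist c) phi A = c phi A))

  & forall (Y : Type) (c : Delta R -> set X -> set X)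
      (d : Delta R -> set Y -> set Y) (f : X -> Y),
      is_closure_tower c -> is_closure_tower d ->
      (contractive (tower_dist c) (tower_dist d) f <->
       forall (A : set X) (phi : Delta R),
         f @` (c phi A) `<=` d phi (f @` A))].
Proof.
split.
- move=> d; split; first exact: is_prob_approach_PDT.
  exact: iff_trans (is_prob_approach_PDT d) (PDT_V_approach d).
- split=> [d dp|c ct].
    by split; [exact: level_closure_tower|exact: tower_dist_level].
  by split; [exact: tower_dist_prob_approach|exact: level_tower_dist].
- by move=> Y c d f; exact: contractive_towerP.
Qed.
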